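(* Let $\Bbbk$ be a field, let $q\in\Bbbk^*$ have a square root in $\Bbbk$, let $\sigma_{inv}$ be the automorphism of $\Bbbk[h^{\pm 1}]$ with $\sigma_{inv}(h)=qh^{-1}$, and let $a\in\Bbbk[h^{\pm 1}]$ be not a monomial. Then every unit of the generalized Weyl algebra $\Bbbk[h^{\pm 1}](\sigma_{inv},a)$ is of the form $\alpha h^i$ with $\alpha\in\Bbbk^*$ and $i\in\mathbb{Z}$.
   Context: For a $\Bbbk$-algebra $R$, a $\Bbbk$-algebra automorphism $\sigma$ of $R$ and a central element $a\in R$, the (degree-one) generalized Weyl algebra $R(\sigma,a)$ is the $\Bbbk$-algebra extension of $R$ generated by two indeterminates $x$ and $y$ subject to the relations $yx=a$, $xy=\sigma(a)$, $xr=\sigma(r)x$ and $yr=\sigma^{-1}(r)y$ for all $r\in R$. A monomial in $\Bbbk[h^{\pm 1}]$ is an element $c h^i$ with $c\in\Bbbk$ and $i\in\mathbb{Z}$ (so a non-monomial is in particular nonzero). *)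

(* Defs.v *)
From HB Require Import structures.
From mathcomp Require Import all_boot all_order all_algebra.
From mathcomp Require Import boolp.

Set Implicit Arguments.
Unset Strict Implicit.
Unset Printing Implicit Defensive.

Import GRing.Theory.
Local Open Scope ring_scope.
Local Open Scope quotient_scope.

(* In a ring with no decidability assumption, units and inverses are obtained *)
(* classically: cunit is two-sided invertibility, and cinv is a two-sided     *)
(* inverse when there is one.                                                 *)
Section ClassicalUnits.
Variable R : nzRingType.

Definition cunit (x : R) : bool := `[< exists y, y * x = 1 /\ x * y = 1 >].

Definition cinv (x : R) : R :=
  if pselect (exists y, y * x = 1 /\ x * y = 1) is left ex
  then projT1 (cid ex) else x.

Lemma cmulVr : {in cunit, left_inverse 1 cinv *%R}.
Proof.
by move=> x /asboolP ex; rewrite /cinv; case: pselect => // ?; case: cid => y [].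
Qed.

Lemma cmulrV : {in cunit, right_inverse 1 cinv *%R}.
Proof.
by move=> x /asboolP ex; rewrite /cinv; case: pselect => // ?; case: cid => y [].
Qed.

Lemma cunitP (x y : R) : y * x = 1 /\ x * y = 1 -> cunit x.
Proof. by move=> xy; apply/asboolP; exists y. Qed.

Lemma cinv_out : {in [predC cunit], cinv =1 id}.
Proof. by move=> x /asboolPn nex; rewrite /cinv; case: pselect. Qed.

End ClassicalUnits.

(* The ring of Laurent polynomials, realised inside the field K(X) as the     *)
(* fractions with denominator a power of X.                                   *)
Section Laurent.
Variable K : fieldType.
Local Notation frac := {fraction {poly K}}.
Local Notation "p %:F" := (@FracField.tofrac {poly K} p).

Definition laurent_frac : {pred frac} :=
  fun f => `[< exists (p : {poly K}) (n : nat), f = p%:F / 'X%:F ^+ n >].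

Lemma laurent_fracP (f : frac) :
  reflect (exists (p : {poly K}) (n : nat), f = p%:F / 'X%:F ^+ n)
          (f \in laurent_frac).
Proof. exact: asboolP. Qed.

Lemma fracXn_neq0 n : ('X : {poly K})%:F ^+ n != 0.
Proof. by rewrite expf_neq0 // tofrac_eq0 polyX_eq0. Qed.

Lemma laurent_frac_closed : subring_closed laurent_frac.
Proof.
split=> [|_ _ /laurent_fracP[p [n ->]] /laurent_fracP[r [m ->]]
         |_ _ /laurent_fracP[p [n ->]] /laurent_fracP[r [m ->]]];
  apply/laurent_fracP.
- by exists 1, 0; rewrite tofrac1 expr0 divr1.
- exists (p * 'X^m - r * 'X^n), (n + m)%N.
  rewrite tofracB !tofracM !tofracXn exprD -mulNr addf_div ?fracXn_neq0 //.
  by rewrite mulNr.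
- by exists (p * r), (n + m)%N; rewrite tofracM exprD mulf_div.
Qed.

HB.instance Definition _ :=
  GRing.isSubringClosed.Build frac laurent_frac laurent_frac_closed.

Record laurent : predArgType :=
  Laurent { lfrac : frac; _ : lfrac \in laurent_frac }.

HB.instance Definition _ := [isSub for lfrac].
HB.instance Definition _ := [Choice of laurent by <:].
HB.instance Definition _ := [SubChoice_isSubComNzRing of laurent by <:].
HB.instance Definition _ := GRing.NzRing_hasMulInverse.Build laurent
  (@cmulVr _) (@cmulrV _) (@cunitP _) (@cinv_out _).

Lemma laurent_mulf_eq0 : GRing.integral_domain_axiom laurent.
Proof.
move=> f g /(congr1 val)/eqP.
by rewrite rmorphM /= -!(inj_eq val_inj) rmorph0 -mulf_eq0.
Qed.

HB.instance Definition _ :=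
  GRing.ComUnitRing_isIntegral.Build laurent laurent_mulf_eq0.

Lemma poly_laurent_frac (p : {poly K}) : p%:F \in laurent_frac.
Proof. by apply/laurent_fracP; exists p, 0; rewrite expr0 divr1. Qed.

Definition poly_laurent (p : {poly K}) : laurent := Laurent (poly_laurent_frac p).

Lemma poly_laurent_zmod : zmod_morphism poly_laurent.
Proof. by move=> p r; apply: val_inj; rewrite rmorphB /= tofracB. Qed.

Lemma poly_laurent_monoid : monoid_morphism poly_laurent.
Proof.
split=> [|p r]; apply: val_inj; first by rewrite rmorph1 /= tofrac1.
by rewrite rmorphM /= tofracM.
Qed.

HB.instance Definition _ :=
  GRing.isZmodMorphism.Build {poly K} laurent poly_laurent poly_laurent_zmod.
HB.instance Definition _ :=
  GRing.isMonoidMorphism.Build {poly K} laurent poly_laurent poly_laurent_monoid.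

Definition laurent_scale (c : K) (f : laurent) : laurent := poly_laurent c%:P * f.

Lemma laurent_scaleA c d f :
  laurent_scale c (laurent_scale d f) = laurent_scale (c * d) f.
Proof. by rewrite /laurent_scale polyCM rmorphM mulrA. Qed.

Lemma laurent_scale1 : left_id 1 laurent_scale.
Proof. by move=> f; rewrite /laurent_scale rmorph1 mul1r. Qed.

Lemma laurent_scaleDr : right_distributive laurent_scale +%R.
Proof. by move=> c f g; rewrite /laurent_scale mulrDr. Qed.

Lemma laurent_scaleDl f : {morph laurent_scale^~ f : c d / c + d}.
Proof. by move=> c d; rewrite /laurent_scale polyCD rmorphD mulrDl. Qed.

HB.instance Definition _ := GRing.Zmodule_isLmodule.Build K laurent
  laurent_scaleA laurent_scale1 laurent_scaleDr laurent_scaleDl.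

Lemma laurent_scaleAl (c : K) (f g : laurent) : c *: (f * g) = c *: f * g.
Proof. exact: mulrA. Qed.

HB.instance Definition _ :=
  GRing.Lmodule_isLalgebra.Build K laurent laurent_scaleAl.
HB.instance Definition _ := GRing.Lalgebra_isComAlgebra.Build K laurent.

Definition laurentX : laurent := poly_laurent 'X.

Lemma laurentX_unit : laurentX \is a GRing.unit.
Proof.
have Xi : ('X : {poly K})%:F^-1 \in laurent_frac.
  by apply/laurent_fracP; exists 1, 1; rewrite tofrac1 div1r.
apply/unitrPr; exists (Laurent Xi); apply: val_inj.
by rewrite rmorphM rmorph1 /= divff // tofrac_eq0 polyX_eq0.
Qed.

(* A monomial may be zero. *)
Definition laurent_monomial (f : laurent) : Prop :=
  exists (c : K) (i : int), f = c *: laurentX ^ i.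

Lemma laurentE (f : laurent) :
  exists (p : {poly K}) (n : nat), f * laurentX ^+ n = poly_laurent p.
Proof.
case: f => f Lf; have /laurent_fracP[p [n def_f]] := Lf.
exists p, n; apply: val_inj.
by rewrite rmorphM rmorphXn /= def_f divfK // fracXn_neq0.
Qed.

Lemma poly_laurent_inj : injective poly_laurent.
Proof. by move=> p r /(congr1 val)/eqP; rewrite /= tofrac_eq => /eqP. Qed.

End Laurent.

Record alg_aut (K : fieldType) (R : algType K) := AlgAut {
  aut_fun :> {lrmorphism R -> R};
  aut_inv : R -> R;
  aut_funK : cancel aut_fun aut_inv;
  aut_invK : cancel aut_inv aut_fun
}.

(* For q != 0 there is an automorphism of the Laurent polynomials exchanging  *)
(* h and q h^-1; it is unique since h generates them.                         *)
Section LaurentInversion.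
Variables (K : fieldType) (q : K).
Hypothesis q_neq0 : q != 0.
Local Notation L := (laurent K).
Local Notation h := (laurentX K).

Let b : L := q *: h^-1.
Let ev : {poly K} -> L := horner_alg b.

Lemma linv_unit : b \is a GRing.unit.
Proof. by rewrite scaler_unit ?unitfE // unitrV laurentX_unit. Qed.

Lemma linv_exists (f : L) : exists g : L,
  forall p n, f * h ^+ n = poly_laurent p -> g * b ^+ n = ev p.
Proof.
have [r [m fr]] := laurentE f; exists (ev r / b ^+ m) => p n fp.
have rp : r * 'X^n = p * 'X^m.
  apply: poly_laurent_inj; rewrite !rmorphM !rmorphXn /= -/h -fr -fp.
  by rewrite mulrAC.
have := congr1 ev rp; rewrite /ev !rmorphM !rmorphXn /= horner_algX -/ev => erp.
by rewrite mulrAC erp mulrK // unitrX // linv_unit.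
Qed.

Definition linv (f : L) : L := projT1 (cid (linv_exists f)).

Lemma linvE f p n : f * h ^+ n = poly_laurent p -> linv f * b ^+ n = ev p.
Proof. by rewrite /linv; case: cid => g /= /[apply]. Qed.

Lemma linv_poly p : linv (poly_laurent p) = ev p.
Proof. by rewrite -[LHS]mulr1 -(expr0 b); apply: linvE; rewrite expr0 mulr1. Qed.

Lemma linv_zmod : zmod_morphism linv.
Proof.
move=> f g; have [p [n fp]] := laurentE f; have [r [m gr]] := laurentE g.
apply: (mulIr (unitrX (n + m) linv_unit)).
rewrite (@linvE _ (p * 'X^m - r * 'X^n)).
  rewrite mulrBl {1}exprD mulrA (linvE fp) addnC exprD mulrA (linvE gr).
  by rewrite /ev rmorphB !rmorphM !rmorphXn /= !horner_algX.
rewrite mulrBl {1}exprD mulrA fp addnC exprD mulrA gr.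
by rewrite rmorphB !rmorphM !rmorphXn.
Qed.

Lemma linv_monoid : monoid_morphism linv.
Proof.
split=> [|f g].
  by rewrite -{1}(rmorph1 (@poly_laurent K)) linv_poly /ev rmorph1.
have [p [n fp]] := laurentE f; have [r [m gr]] := laurentE g.
apply: (mulIr (unitrX (n + m) linv_unit)).
rewrite (@linvE _ (p * r)).
  by rewrite exprD mulrACA (linvE fp) (linvE gr) /ev rmorphM.
by rewrite exprD mulrACA fp gr -rmorphM.
Qed.

Lemma linv_scale : scalable linv.
Proof.
move=> c f; rewrite [c *: f]/(poly_laurent c%:P * f) linv_monoid.2 linv_poly.
by rewrite /ev horner_algC -scalerAl mul1r.
Qed.

HB.instance Definition _ := GRing.isZmodMorphism.Build L L linv linv_zmod.
HB.instance Definition _ := GRing.isMonoidMorphism.Build L L linv linv_monoid.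
HB.instance Definition _ := GRing.isScalable.Build K L L *:%R linv linv_scale.

Lemma linvX : linv h = b.
Proof. by rewrite linv_poly /ev horner_algX. Qed.

Lemma linvK : involutive linv.
Proof.
have linvb : linv b = h.
  rewrite /b linearZ rmorphV ?laurentX_unit //= linvX /b invrZ ?unitfE //.
    by rewrite invrK scalerA divff // scale1r.
  by rewrite unitrV laurentX_unit.
have linv_ev p : linv (ev p) = poly_laurent p.
  elim/poly_ind: p => [|p c IHp]; first by rewrite /ev !rmorph0.
  rewrite /ev !rmorphD !rmorphM /= horner_algX horner_algC linvb.
  by rewrite -/(ev p) IHp linearZ rmorph1 /= [c *: 1]mulr1.
move=> f; have [p [n fp]] := laurentE f.
apply: (mulIr (unitrX n (laurentX_unit K))); rewrite fp -linv_ev.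
by rewrite -(linvE fp) rmorphM rmorphXn /= linvb.
Qed.

Lemma laurent_inversion :
  exists sigma : alg_aut L, sigma h = q *: h^-1.
Proof. by exists (AlgAut linvK linvK); apply: linvX. Qed.

End LaurentInversion.

(* The generalized Weyl algebra, by generators and relations: expressions in  *)
(* the elements of R and in x and y, modulo the least ring congruence that    *)
(* makes R -> gwa a ring morphism and contains the four families of           *)
(* relations.                                                                 *)
Section GWA.
Variables (K : fieldType) (R : algType K).

Inductive gwa_term : Type :=
| GwaR of R
| GwaX
| GwaY
| GwaAdd of gwa_term & gwa_term
| GwaOpp of gwa_term
| GwaMul of gwa_term & gwa_term.

HB.instance Definition _ := gen_eqMixin gwa_term.
HB.instance Definition _ := gen_choiceMixin gwa_term.

Variables (sigma : alg_aut R) (a : R).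

Inductive gwa_cong : gwa_term -> gwa_term -> Prop :=
| gwa_refl t : gwa_cong t t
| gwa_sym t u : gwa_cong t u -> gwa_cong u t
| gwa_trans t u v : gwa_cong t u -> gwa_cong u v -> gwa_cong t v
| gwa_congD t t' u u' : gwa_cong t t' -> gwa_cong u u' ->
    gwa_cong (GwaAdd t u) (GwaAdd t' u')
| gwa_congN t t' : gwa_cong t t' -> gwa_cong (GwaOpp t) (GwaOpp t')
| gwa_congM t t' u u' : gwa_cong t t' -> gwa_cong u u' ->
    gwa_cong (GwaMul t u) (GwaMul t' u')
| gwa_addA t u v :
    gwa_cong (GwaAdd t (GwaAdd u v)) (GwaAdd (GwaAdd t u) v)
| gwa_addC t u : gwa_cong (GwaAdd t u) (GwaAdd u t)
| gwa_add0 t : gwa_cong (GwaAdd (GwaR 0) t) t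
| gwa_addN t : gwa_cong (GwaAdd (GwaOpp t) t) (GwaR 0)
| gwa_mulA t u v :
    gwa_cong (GwaMul t (GwaMul u v)) (GwaMul (GwaMul t u) v)
| gwa_mul1l t : gwa_cong (GwaMul (GwaR 1) t) t
| gwa_mul1r t : gwa_cong (GwaMul t (GwaR 1)) t
| gwa_mulDl t u v :
    gwa_cong (GwaMul (GwaAdd t u) v) (GwaAdd (GwaMul t v) (GwaMul u v))
| gwa_mulDr t u v :
    gwa_cong (GwaMul t (GwaAdd u v)) (GwaAdd (GwaMul t u) (GwaMul t v))
| gwa_RD r s : gwa_cong (GwaR (r + s)) (GwaAdd (GwaR r) (GwaR s))
| gwa_RM r s : gwa_cong (GwaR (r * s)) (GwaMul (GwaR r) (GwaR s))
| gwa_yx : gwa_cong (GwaMul GwaY GwaX) (GwaR a)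
| gwa_xy : gwa_cong (GwaMul GwaX GwaY) (GwaR (sigma a))
| gwa_xr r : gwa_cong (GwaMul GwaX (GwaR r)) (GwaMul (GwaR (sigma r)) GwaX)
| gwa_yr r :
    gwa_cong (GwaMul GwaY (GwaR r)) (GwaMul (GwaR (aut_inv sigma r)) GwaY).

Definition gwa_congb : rel gwa_term := fun t u => `[< gwa_cong t u >].

Lemma gwa_congb_refl : reflexive gwa_congb.
Proof. by move=> t; apply/asboolP/gwa_refl. Qed.

Lemma gwa_congb_sym : symmetric gwa_congb.
Proof. by move=> t u; apply/asboolP/asboolP => /gwa_sym. Qed.

Lemma gwa_congb_trans : transitive gwa_congb.
Proof.
by move=> u t v /asboolP tu /asboolP uv; apply/asboolP/(gwa_trans tu uv).
Qed.

Canonical gwa_congb_equiv :=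
  EquivRel gwa_congb gwa_congb_refl gwa_congb_sym gwa_congb_trans.


(* R-valued functions on the integers carry a representation of these         *)
(* relations in which r acts as multiplication by sigma^i r at place i; it    *)
(* shows that R embeds in gwa, hence that 1 != 0 there.                       *)
Definition aut_pow (i : int) (r : R) : R :=
  match i with
  | Posz n => iter n sigma r
  | Negz n => iter n.+1 (aut_inv sigma) r
  end.

Fixpoint gwa_act (t : gwa_term) (f : int -> R) : int -> R :=
  match t with
  | GwaR r => fun i => aut_pow i r * f i
  | GwaX => fun i => f (i + 1)
  | GwaY => fun i => aut_pow i a * f (i - 1)
  | GwaAdd t u => fun i => gwa_act t f i + gwa_act u f i
  | GwaOpp t => fun i => - gwa_act t f i
  | GwaMul t u => gwa_act t (gwa_act u f)
  end.

Lemma aut_inv_zmod : zmod_morphism (aut_inv sigma).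
Proof.
by move=> r s; apply: (can_inj (aut_funK sigma)); rewrite rmorphB /= !aut_invK.
Qed.

Lemma aut_inv_monoid : monoid_morphism (aut_inv sigma).
Proof.
split=> [|r s]; apply: (can_inj (aut_funK sigma)).
  by rewrite rmorph1 aut_invK.
by rewrite rmorphM /= !aut_invK.
Qed.

Lemma aut_inv0 : aut_inv sigma 0 = 0.
Proof. by apply: (can_inj (aut_funK sigma)); rewrite aut_invK rmorph0. Qed.

Lemma aut_invD : {morph aut_inv sigma : r s / r + s}.
Proof.
by move=> r s; apply: (can_inj (aut_funK sigma)); rewrite rmorphD /= !aut_invK.
Qed.

Lemma aut_pow0 i : aut_pow i 0 = 0.
Proof.
case: i => n; rewrite /aut_pow; first by elim: n => //= n ->; exact: rmorph0.
by elim: n.+1 => //= m ->; exact: aut_inv0.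
Qed.

Lemma aut_pow1 i : aut_pow i 1 = 1.
Proof.
case: i => n; rewrite /aut_pow; first by elim: n => //= n ->; exact: rmorph1.
by elim: n.+1 => //= m ->; exact: aut_inv_monoid.1.
Qed.

Lemma aut_powD i : {morph aut_pow i : r s / r + s}.
Proof.
move=> r s; case: i => n; rewrite /aut_pow.
  by elim: n => //= n ->; exact: rmorphD.
by elim: n.+1 => //= m ->; exact: aut_invD.
Qed.

Lemma aut_powM i : {morph aut_pow i : r s / r * s}.
Proof.
move=> r s; case: i => n; rewrite /aut_pow.
  by elim: n => //= n ->; exact: rmorphM.
by elim: n.+1 => //= m ->; exact: aut_inv_monoid.2.
Qed.

Lemma aut_powS i r : aut_pow (i + 1) r = aut_pow i (sigma r).
Proof.
case: i => [n | [|n]].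
- by rewrite /aut_pow -PoszD addn1 iterSr.
- by rewrite /= aut_funK.
- rewrite (_ : Negz n.+1 + 1 = Negz n); last first.
    by rewrite !NegzE -[n.+2]addn1 PoszD opprD addrNK.
  by rewrite /aut_pow [in RHS]iterSr aut_funK.
Qed.

Lemma aut_powB i r : aut_pow (i - 1) r = aut_pow i (aut_inv sigma r).
Proof. by rewrite -{2}(subrK 1 i) aut_powS aut_invK. Qed.

Lemma gwa_actD t f g i :
  gwa_act t (fun j => f j + g j) i = gwa_act t f i + gwa_act t g i.
Proof.
elim: t f g i => [r|||t IHt u IHu|t IHt|t IHt u IHu] f g i //=.
- by rewrite mulrDr.
- by rewrite mulrDr.
- by rewrite IHt IHu addrACA.
- by rewrite IHt opprD.
- by rewrite -IHt; congr (gwa_act t _ i); apply: funext => j; rewrite IHu.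
Qed.

Hypothesis central_a : forall r : R, GRing.comm a r.

Lemma aut_pow_central i r : GRing.comm (aut_pow i a) r.
Proof.
case: i => n; rewrite /aut_pow.
  elim: n r => [|n IHn] r; first exact: central_a.
  rewrite iterS -[r](aut_invK sigma).
  by rewrite /GRing.comm -!rmorphM IHn.
elim: n.+1 r => [|m IHm] r; first exact: central_a.
rewrite iterS -[r](aut_funK sigma).
by rewrite /GRing.comm -!aut_inv_monoid.2 IHm.
Qed.

Lemma gwa_cong_act t u : gwa_cong t u -> gwa_act t = gwa_act u.
Proof.
move=> tu; apply/funext => f; apply/funext => i.
elim: tu f i => {t u} //=.
- by move=> t u v _ IHt _ IHu f i; rewrite IHt IHu.
- by move=> t t' u u' _ IHt _ IHu f i; rewrite IHt IHu.
- by move=> t t' _ IHt f i; rewrite IHt.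
- move=> t t' u u' _ IHt _ IHu f i; rewrite IHt.
  by congr (gwa_act t' _ i); apply: funext => j.
- by move=> t u v f i; rewrite addrA.
- by move=> t u f i; rewrite addrC.
- by move=> t f i; rewrite aut_pow0 mul0r add0r.
- by move=> t f i; rewrite aut_pow0 mul0r addNr.
- by move=> t f i; rewrite aut_pow1 mul1r.
- move=> t f i; congr (gwa_act t _ i); apply: funext => j.
  by rewrite aut_pow1 mul1r.
- by move=> t u v f i; rewrite gwa_actD.
- by move=> r s f i; rewrite aut_powD mulrDl.
- by move=> r s f i; rewrite aut_powM mulrA.
- by move=> f i; rewrite subrK.
- by move=> f i; rewrite aut_powS addrK.
- by move=> r f i; rewrite aut_powS.
- by move=> r f i; rewrite aut_powB !mulrA aut_pow_central.
Qed.

(* Only meaningful for a central a, so a proof of centrality is an argument. *)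
Definition gwa of (forall r : R, GRing.comm a r) : Type := {eq_quot gwa_congb}.

Local Notation A := (gwa central_a).

HB.instance Definition _ := Choice.on A.
HB.instance Definition _ := EqQuotient.on A.

Lemma gwa_eqP t u : \pi_A t = \pi_A u <-> gwa_cong t u.
Proof. by split=> [/eqmodP/asboolP | tu]; last exact/eqmodP/asboolP. Qed.

Definition gwa_add := lift_op2 A GwaAdd.
Definition gwa_opp := lift_op1 A GwaOpp.
Definition gwa_mul := lift_op2 A GwaMul.

Lemma gwa_repr t : gwa_cong (repr (\pi_A t)) t.
Proof. by apply/gwa_eqP; rewrite reprK. Qed.

Lemma gwa_piD t u : gwa_add (\pi_A t) (\pi_A u) = \pi_A (GwaAdd t u).
Proof. by unlock gwa_add; apply/gwa_eqP/gwa_congD; apply: gwa_repr. Qed.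

Lemma gwa_piN t : gwa_opp (\pi_A t) = \pi_A (GwaOpp t).
Proof. by unlock gwa_opp; apply/gwa_eqP/gwa_congN/gwa_repr. Qed.

Lemma gwa_piM t u : gwa_mul (\pi_A t) (\pi_A u) = \pi_A (GwaMul t u).
Proof. by unlock gwa_mul; apply/gwa_eqP/gwa_congM; apply: gwa_repr. Qed.

Definition gwa_pi := (gwa_piD, gwa_piN, gwa_piM).

Lemma gwa_ringA : associative gwa_add.
Proof.
elim/quotW=> t; elim/quotW=> u; elim/quotW=> v.
by rewrite !gwa_pi; apply/gwa_eqP/gwa_addA.
Qed.

Lemma gwa_ringC : commutative gwa_add.
Proof.
by elim/quotW=> t; elim/quotW=> u; rewrite !gwa_pi; apply/gwa_eqP/gwa_addC.
Qed.

Lemma gwa_ring0 : left_id (\pi_A (GwaR 0)) gwa_add.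
Proof. by elim/quotW=> t; rewrite !gwa_pi; apply/gwa_eqP/gwa_add0. Qed.

Lemma gwa_ringN : left_inverse (\pi_A (GwaR 0)) gwa_opp gwa_add.
Proof. by elim/quotW=> t; rewrite !gwa_pi; apply/gwa_eqP/gwa_addN. Qed.

HB.instance Definition _ :=
  GRing.isZmodule.Build A gwa_ringA gwa_ringC gwa_ring0 gwa_ringN.

Lemma gwa_ringMA : associative gwa_mul.
Proof.
elim/quotW=> t; elim/quotW=> u; elim/quotW=> v.
by rewrite !gwa_pi; apply/gwa_eqP/gwa_mulA.
Qed.

Lemma gwa_ring1l : left_id (\pi_A (GwaR 1)) gwa_mul.
Proof. by elim/quotW=> t; rewrite !gwa_pi; apply/gwa_eqP/gwa_mul1l. Qed.

Lemma gwa_ring1r : right_id (\pi_A (GwaR 1)) gwa_mul.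
Proof. by elim/quotW=> t; rewrite !gwa_pi; apply/gwa_eqP/gwa_mul1r. Qed.

Lemma gwa_ringMDl : left_distributive gwa_mul gwa_add.
Proof.
elim/quotW=> t; elim/quotW=> u; elim/quotW=> v.
by rewrite !gwa_pi; apply/gwa_eqP/gwa_mulDl.
Qed.

Lemma gwa_ringMDr : right_distributive gwa_mul gwa_add.
Proof.
elim/quotW=> t; elim/quotW=> u; elim/quotW=> v.
by rewrite !gwa_pi; apply/gwa_eqP/gwa_mulDr.
Qed.

Lemma gwa_piR_inj : injective (fun r => \pi_A (GwaR r)).
Proof.
move=> r s /gwa_eqP/gwa_cong_act/(congr1 (fun F => F (fun=> 1) 0)) /=.
by rewrite !mulr1.
Qed.

Lemma gwa_ring1_neq0 : \pi_A (GwaR 1) != \pi_A (GwaR 0).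
Proof. by apply/eqP => /gwa_piR_inj/eqP; rewrite oner_eq0. Qed.

HB.instance Definition _ := GRing.Zmodule_isNzRing.Build A
  gwa_ringMA gwa_ring1l gwa_ring1r gwa_ringMDl gwa_ringMDr gwa_ring1_neq0.

Definition gwa_in (r : R) : A := \pi_A (GwaR r).
Definition gwa_x : A := \pi_A GwaX.
Definition gwa_y : A := \pi_A GwaY.

Lemma gwa_in_inj : injective gwa_in.
Proof. exact: gwa_piR_inj. Qed.

Lemma gwa_inD : {morph gwa_in : r s / r + s}.
Proof. by move=> r s; rewrite [RHS]gwa_piD; apply/gwa_eqP/gwa_RD. Qed.

Lemma gwa_in_zmod : zmod_morphism gwa_in.
Proof. by move=> r s; apply: (addIr (gwa_in s)); rewrite -gwa_inD !subrK. Qed.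

Lemma gwa_in_monoid : monoid_morphism gwa_in.
Proof. by split=> // r s; rewrite [RHS]gwa_piM; apply/gwa_eqP/gwa_RM. Qed.

HB.instance Definition _ := GRing.isZmodMorphism.Build R A gwa_in gwa_in_zmod.
HB.instance Definition _ :=
  GRing.isMonoidMorphism.Build R A gwa_in gwa_in_monoid.

Lemma gwa_yxE : gwa_y * gwa_x = gwa_in a.
Proof. by rewrite [LHS]gwa_piM; apply/gwa_eqP/gwa_yx. Qed.

Lemma gwa_xyE : gwa_x * gwa_y = gwa_in (sigma a).
Proof. by rewrite [LHS]gwa_piM; apply/gwa_eqP/gwa_xy. Qed.

Lemma gwa_xrE r : gwa_x * gwa_in r = gwa_in (sigma r) * gwa_x.
Proof. by rewrite [LHS]gwa_piM [RHS]gwa_piM; apply/gwa_eqP/gwa_xr. Qed.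

Lemma gwa_yrE r : gwa_y * gwa_in r = gwa_in (aut_inv sigma r) * gwa_y.
Proof. by rewrite [LHS]gwa_piM [RHS]gwa_piM; apply/gwa_eqP/gwa_yr. Qed.

Lemma gwa_ind (P : A -> Prop) :
    (forall r, P (gwa_in r)) -> P gwa_x -> P gwa_y ->
    (forall u v, P u -> P v -> P (u + v)) ->
    (forall u, P u -> P (- u)) ->
    (forall u v, P u -> P v -> P (u * v)) ->
  forall u, P u.
Proof.
move=> PR PX PY PD PN PM; elim/quotW; elim=> // [t Pt u Pu|t Pt|t Pt u Pu].
- by rewrite -gwa_piD; apply: PD.
- by rewrite -gwa_piN; apply: PN.
- by rewrite -gwa_piM; apply: PM.
Qed.

Definition gwa_scale (c : K) (u : A) : A := gwa_in c%:A * u.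

Lemma gwa_scaleA c d u : gwa_scale c (gwa_scale d u) = gwa_scale (c * d) u.
Proof. by rewrite /gwa_scale mulrA -rmorphM -scalerAl mul1r scalerA. Qed.

Lemma gwa_scale1 : left_id 1 gwa_scale.
Proof. by move=> u; rewrite /gwa_scale scale1r rmorph1 mul1r. Qed.

Lemma gwa_scaleDr : right_distributive gwa_scale +%R.
Proof. by move=> c u v; rewrite /gwa_scale mulrDr. Qed.

Lemma gwa_scaleDl u : {morph gwa_scale^~ u : c d / c + d}.
Proof. by move=> c d; rewrite /gwa_scale scalerDl rmorphD mulrDl. Qed.

HB.instance Definition _ := GRing.Zmodule_isLmodule.Build K A
  gwa_scaleA gwa_scale1 gwa_scaleDr gwa_scaleDl.

Lemma gwa_scaleAl (c : K) (u v : A) : c *: (u * v) = c *: u * v.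
Proof. exact: mulrA. Qed.

HB.instance Definition _ := GRing.Lmodule_isLalgebra.Build K A gwa_scaleAl.

Lemma gwa_scalar_comm (c : K) (u : A) : GRing.comm (gwa_in c%:A) u.
Proof.
elim/gwa_ind: u => [r|||u v cu cv|u cu|u v cu cv].
- by rewrite /GRing.comm -!rmorphM -scalerAl -scalerAr mul1r mulr1.
- by rewrite /GRing.comm gwa_xrE linearZ rmorph1.
- rewrite /GRing.comm gwa_yrE; congr (gwa_in _ * _).
  by rewrite -[LHS](aut_funK sigma) linearZ rmorph1.
- exact: commrD.
- exact: commrN.
- exact: commrM.
Qed.

Lemma gwa_scaleAr (c : K) (u v : A) : c *: (u * v) = u * (c *: v).
Proof.
by rewrite [LHS]mulrA [u * _]mulrA gwa_scalar_comm.
Qed.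

HB.instance Definition _ := GRing.Lalgebra_isAlgebra.Build K A gwa_scaleAr.

HB.instance Definition _ := GRing.NzRing_hasMulInverse.Build A
  (@cmulVr _) (@cmulrV _) (@cunitP _) (@cinv_out _).

Lemma gwa_in_scale : scalable gwa_in.
Proof.
by move=> c r; rewrite -[r in LHS]mul1r scalerAl rmorphM.
Qed.

HB.instance Definition _ := GRing.isScalable.Build K R A *:%R gwa_in gwa_in_scale.

(* The universal property of gwa; uniqueness is gwa_ind. *)
Section Lift.
Variables (B : algType K) (f : {lrmorphism R -> B}) (x y : B).
Hypotheses (yx : y * x = f a) (xy : x * y = f (sigma a)).
Hypotheses (xr : forall r, x * f r = f (sigma r) * x).
Hypotheses (yr : forall r, y * f r = f (aut_inv sigma r) * y).

Fixpoint gwa_eval (t : gwa_term) : B :=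
  match t with
  | GwaR r => f r
  | GwaX => x
  | GwaY => y
  | GwaAdd t u => gwa_eval t + gwa_eval u
  | GwaOpp t => - gwa_eval t
  | GwaMul t u => gwa_eval t * gwa_eval u
  end.

Lemma gwa_cong_eval t u : gwa_cong t u -> gwa_eval t = gwa_eval u.
Proof.
elim=> {t u} //=.
- by move=> t u v _ -> _ ->.
- by move=> t t' u u' _ -> _ ->.
- by move=> t t' _ ->.
- by move=> t t' u u' _ -> _ ->.
- by move=> t u v; rewrite addrA.
- by move=> t u; rewrite addrC.
- by move=> t; rewrite rmorph0 add0r.
- by move=> t; rewrite rmorph0 addNr.
- by move=> t u v; rewrite mulrA.
- by move=> t; rewrite rmorph1 mul1r.
- by move=> t; rewrite rmorph1 mulr1.
- by move=> t u v; rewrite mulrDl.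
- by move=> t u v; rewrite mulrDr.
- exact: rmorphD.
- exact: rmorphM.
Qed.

Definition gwa_lift (u : A) : B := gwa_eval (repr u).

Lemma gwa_lift_pi t : gwa_lift (\pi_A t) = gwa_eval t.
Proof. exact/gwa_cong_eval/gwa_repr. Qed.

Lemma gwa_universal : exists g : {lrmorphism A -> B},
  [/\ forall r, g (gwa_in r) = f r, g gwa_x = x & g gwa_y = y].
Proof.
have gB : zmod_morphism gwa_lift.
  elim/quotW=> t; elim/quotW=> u.
  have -> : \pi_A t - \pi_A u = \pi_A (GwaAdd t (GwaOpp u)).
    by rewrite -gwa_piD -gwa_piN.
  by rewrite !gwa_lift_pi.
have gM : monoid_morphism gwa_lift.
  split; first by rewrite gwa_lift_pi /= rmorph1.
  elim/quotW=> t; elim/quotW=> u.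
  have -> : \pi_A t * \pi_A u = \pi_A (GwaMul t u) by rewrite -gwa_piM.
  by rewrite !gwa_lift_pi.
have gZ : scalable gwa_lift.
  move=> c u; rewrite [c *: u]/(gwa_in c%:A * u) gM.2 gwa_lift_pi /=.
  by rewrite linearZ rmorph1 -scalerAl mul1r.
pose gBi := GRing.isZmodMorphism.Build A B gwa_lift gB.
pose gMi := GRing.isMonoidMorphism.Build A B gwa_lift gM.
pose gZi := GRing.isScalable.Build K A B *:%R gwa_lift gZ.
pose g : {lrmorphism A -> B} := HB.pack gwa_lift gBi gMi gZi.
by exists g; split=> [r||]; apply: gwa_lift_pi.
Qed.

End Lift.
End GWA.

(* Main.v *)
(* Every element of a generalized Weyl algebra over a domain R is a finite    *)
(* sum of terms c x^n and d y^n.  In the representation on functions int -> R *)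
(* each such term shifts by a fixed degree with nonzero coefficients, so      *)
(* the terms of largest (resp. smallest) degree of two factors of 1 multiply  *)
(* to something nonzero: both pairs of extremal degrees add up to 0, and both *)
(* factors are homogeneous, of opposite degrees.  If these degrees are not 0, *)
(* the product of the factors involves some y x = a or x y = sigma(a), and a  *)
(* is invertible.  So when a is not a unit both factors lie in R; and the     *)
(* units of the Laurent polynomials are the nonzero monomials, since the      *)
(* divisors of a power of X are monomials.                                    *)
Require Import Defs.
From mathcomp Require Import all_boot all_order all_algebra.
From mathcomp Require Import boolp.
Import Order.TTheory GRing.Theory Num.Theory.
Local Open Scope ring_scope.

Set Implicit Arguments.
Unset Strict Implicit.
Unset Printing Implicit Defensive.

(** The argument is the one for units of a graded domain, with the degree read off from an action.
    By [gwa_normal_form] an element is a finite sum of terms of distinct degrees with nonzero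
    coefficients. Each term acts on functions [int -> R] as a shift by its degree with nonvanishing
    weights, so extremal terms of a product cannot cancel ([gwa_sum_mul1]). Hence if [u * v = 1],
    both factors are homogeneous, of opposite degrees ([gwa_mul1_homogeneous]). Nonzero degree would
    make [a] divide 1 ([gwa_mul1_in]). By [laurent_unit_monomial] a non-monomial Laurent polynomial
    is not a unit, so [u] lies in the base ring, where the same lemma makes it a monomial. *)

Lemma seq_extremum d (T : orderType d) (s : seq T) :
  s != [::] -> exists2 m, m \in s & {in s, forall k, (k <= m)%O}.
Proof.
elim: s => // k [|l s] IHs _.
  by exists k; [rewrite mem_head | move=> j; rewrite inE => /eqP->].
have [//|m sm max_m] := IHs; case: (leP k m) => [km|/ltW mk].
  by exists m; [rewrite inE sm orbT | move=> j; rewrite inE => /predU1P[->|/max_m]].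
exists k; first exact: mem_head.
by move=> j; rewrite inE => /predU1P[->|/max_m/le_trans->].
Qed.

(** * Normal form of elements as sums over degrees *)

Section GwaNormalForm.
Variables (K : fieldType) (R : algType K) (sigma : alg_aut R) (a : R).
Hypothesis central_a : forall r : R, GRing.comm a r.
Local Notation A := (gwa sigma central_a).
Local Notation inA := (gwa_in sigma central_a).
Local Notation x := (gwa_x sigma central_a).
Local Notation y := (gwa_y sigma central_a).

Definition gwa_mon (m : int) : A :=
  match m with Posz n => x ^+ n | Negz n => y ^+ n.+1 end.

Definition gwa_sum (s : seq int) (c : int -> R) : A :=
  \sum_(k <- s) inA (c k) * gwa_mon k.

(** In negative degree [x] cancels one [y] and leaves [sigma a]; otherwise the coefficient is 1.
    With [gwa_y_mon], this makes the span of the monomials stable under left multiplication. *)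
Lemma gwa_x_mon m : exists r, x * gwa_mon m = inA r * gwa_mon (m + 1).
Proof.
case: m => n.
  by exists 1; rewrite rmorph1 mul1r -PoszD addn1 /= exprS.
exists (sigma a); rewrite /= exprS mulrA gwa_xyE; congr (_ * _).
case: n => [|n]; first by rewrite expr0.
by rewrite (_ : Negz n.+1 + 1 = Negz n) // !NegzE -[n.+2]addn1 PoszD opprD addrNK.
Qed.

Lemma gwa_y_mon m : exists r, y * gwa_mon m = inA r * gwa_mon (m - 1).
Proof.
case: m => [[|n]|n].
- by exists 1; rewrite rmorph1 mul1r /= expr0 mulr1 expr1.
- have -> : n.+1%:Z - 1 = n by rewrite -addn1 PoszD addrK.
  by exists a; rewrite /= exprS mulrA gwa_yxE.
exists 1; rewrite rmorph1 mul1r (_ : Negz n - 1 = Negz n.+1) /=; last first.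
  by rewrite !NegzE -[n.+2]addn1 PoszD opprD.
by rewrite -exprS.
Qed.

Definition gwa_spanned (u : A) :=
  exists s : seq (int * R), u = \sum_(p <- s) inA p.2 * gwa_mon p.1.

Lemma gwa_spanned_sum I (r : seq I) (F : I -> A) :
  (forall i, gwa_spanned (F i)) -> gwa_spanned (\sum_(i <- r) F i).
Proof.
move=> FP; apply: (big_ind gwa_spanned) => //; first by exists [::]; rewrite big_nil.
by move=> _ _ [s ->] [t ->]; exists (s ++ t); rewrite big_cat.
Qed.

Lemma gwa_spanned1 r m : gwa_spanned (inA r * gwa_mon m).
Proof. by exists [:: (m, r)]; rewrite big_seq1. Qed.

Lemma gwa_spannedP u : gwa_spanned u.
Proof.
(* Replacing [u] by [u * 1] and generalizing 1 turns the goal into stability of the span under left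
   multiplication by [u], which passes through products. *)
rewrite -[u]mulr1.
have: gwa_spanned 1 by exists [:: (0, 1)]; rewrite big_seq1 rmorph1 mul1r.
elim/gwa_ind: u 1 => [r|||u v IHu IHv|u IHu|u v IHu IHv] w Pw.
- case: Pw => s ->; rewrite mulr_sumr; apply: gwa_spanned_sum => p.
  by rewrite mulrA -rmorphM; apply: gwa_spanned1.
- case: Pw => s ->; rewrite mulr_sumr; apply: gwa_spanned_sum => p.
  have [r xm] := gwa_x_mon p.1.
  by rewrite mulrA gwa_xrE -mulrA xm mulrA -rmorphM; apply: gwa_spanned1.
- case: Pw => s ->; rewrite mulr_sumr; apply: gwa_spanned_sum => p.
  have [r ym] := gwa_y_mon p.1.
  by rewrite mulrA gwa_yrE -mulrA ym mulrA -rmorphM; apply: gwa_spanned1.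
- have [[s us] [t vt]] := (IHu w Pw, IHv w Pw).
  by exists (s ++ t); rewrite mulrDl us vt big_cat.
- rewrite mulNr; have [s ->] := IHu w Pw; rewrite -sumrN.
  by apply: gwa_spanned_sum => p; rewrite -mulNr -rmorphN; apply: gwa_spanned1.
- by rewrite -mulrA; apply/IHu/IHv.
Qed.

Lemma gwa_normal_form (u : A) :
  exists s c, [/\ uniq s, {in s, forall k, c k != 0} & u = gwa_sum s c].
Proof.
have [t ->] := gwa_spannedP u.
(* Terms of equal degree are merged, then the degrees whose total coefficient vanishes are
   dropped. *)
pose c k := \sum_(p <- t | p.1 == k) p.2.
pose s0 := undup [seq p.1 | p <- t].
exists [seq k <- s0 | c k != 0], c; split.
- by rewrite filter_uniq ?undup_uniq.
- by move=> k; rewrite mem_filter => /andP[].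
rewrite /gwa_sum big_filter.
transitivity (\sum_(k <- s0) inA (c k) * gwa_mon k); last first.
  rewrite [RHS]big_mkcond; apply: eq_bigr => k _.
  by case: eqVneq => //= ->; rewrite rmorph0 mul0r.
transitivity (\sum_(k <- s0) \sum_(p <- t | p.1 == k) inA p.2 * gwa_mon p.1).
  rewrite (exchange_big_dep xpredT) //= big_seq [RHS]big_seq.
  apply: eq_bigr => p tp; rewrite (eq_bigl (pred1 p.1)) => [|k]; last exact: eq_sym.
  by rewrite -big_filter filter_pred1_uniq ?undup_uniq ?big_seq1 // mem_undup map_f.
apply: eq_bigr => k _; rewrite /c rmorph_sum mulr_suml /=.
by apply: eq_bigr => p /eqP->.
Qed.

(** * Action of the monomials on functions *)

(** The product $\sigma^i(a)\,\sigma^{i-1}(a)\cdots\sigma^{i-n+1}(a)$ that [y ^+ n] picks up at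
    place [i], while [x ^+ n] is a pure shift. *)
Fixpoint y_weight n i : R :=
  if n is n'.+1 then aut_pow sigma i a * y_weight n' (i - 1) else 1.

Definition mon_weight (m i : int) : R :=
  match m with Posz _ => 1 | Negz n => y_weight n.+1 i end.

Definition gwa_op (u : A) := gwa_act sigma a (repr u).

Lemma gwa_op_pi t : gwa_op (\pi_A t)%qT = gwa_act sigma a t.
Proof. exact/(gwa_cong_act central_a)/gwa_repr. Qed.

Lemma gwa_opM u v f : gwa_op (u * v) f = gwa_op u (gwa_op v f).
Proof.
elim/quotW: u => t; elim/quotW: v => t'.
have -> : (\pi_A t * \pi_A t' = \pi_A (GwaMul t t'))%qT by rewrite -gwa_piM.
by rewrite !gwa_op_pi.
Qed.

Lemma gwa_opD u v f i : gwa_op (u + v) f i = gwa_op u f i + gwa_op v f i.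
Proof.
elim/quotW: u => t; elim/quotW: v => t'.
have -> : (\pi_A t + \pi_A t' = \pi_A (GwaAdd t t'))%qT by rewrite -gwa_piD.
by rewrite !gwa_op_pi.
Qed.

Lemma gwa_op_in r f i : gwa_op (inA r) f i = aut_pow sigma i r * f i.
Proof. by rewrite gwa_op_pi. Qed.

Lemma gwa_op1 f : gwa_op 1 f = f.
Proof.
by apply: funext => i; rewrite -(rmorph1 (gwa_in sigma central_a)) gwa_op_in aut_pow1 mul1r.
Qed.

Lemma gwa_op_mon m f i : gwa_op (gwa_mon m) f i = mon_weight m i * f (i + m).
Proof.
have opX n j : gwa_op (x ^+ n) f j = f (j + n%:Z).
  elim: n j => [|n IHn] j; first by rewrite expr0 gwa_op1 addr0.
  by rewrite exprS gwa_opM gwa_op_pi /= IHn -addrA -PoszD.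
have opY n j : gwa_op (y ^+ n) f j = y_weight n j * f (j - n%:Z).
  elim: n j => [|n IHn] j; first by rewrite expr0 gwa_op1 subr0 mul1r.
  by rewrite exprS gwa_opM gwa_op_pi /= IHn -addrA -opprD -PoszD mulrA.
by case: m => n; [rewrite mul1r opX | rewrite opY NegzE].
Qed.

Lemma gwa_op_sum s c f i :
  gwa_op (gwa_sum s c) f i =
  \sum_(k <- s) aut_pow sigma i (c k) * mon_weight k i * f (i + k).
Proof.
rewrite /gwa_sum; elim: s => [|k s IHs].
  by rewrite !big_nil -(rmorph0 (gwa_in sigma central_a)) gwa_op_in aut_pow0 mul0r.
by rewrite !big_cons gwa_opD IHs gwa_opM gwa_op_in gwa_op_mon mulrA.
Qed.

Lemma aut_pow_inj i : injective (aut_pow sigma i).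
Proof.
move=> r s; case: i => n; rewrite /aut_pow.
  by elim: n => //= n IHn /(can_inj (aut_funK sigma))/IHn.
by elim: n.+1 => //= m IHm /(can_inj (aut_invK sigma))/IHm.
Qed.

Lemma aut_pow_eq0 i r : (aut_pow sigma i r == 0) = (r == 0).
Proof. by rewrite -{1}(aut_pow0 sigma i) (inj_eq (@aut_pow_inj i)). Qed.

(** * Factorizations of 1 over a domain *)

Section Units.
Hypothesis domR : forall r s : R, r * s = 0 -> (r == 0) || (s == 0).
Hypothesis a_neq0 : a != 0.

Lemma domain_mulf_neq0 (r s : R) : r != 0 -> s != 0 -> r * s != 0.
Proof. by move=> r0 s0; apply/eqP => /domR; rewrite (negPf r0) (negPf s0). Qed.

Lemma mon_weight_neq0 m i : mon_weight m i != 0.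
Proof.
have yw n j : y_weight n j != 0.
  elim: n j => [|n IHn] j /=; first exact: oner_neq0.
  by rewrite domain_mulf_neq0 ?aut_pow_eq0.
by case: m => n; [apply: oner_neq0 | apply: yw].
Qed.

Definition dirac (k j : int) : R := (j == k)%:R.

Lemma gwa_op_dirac_in s c k i : uniq s -> k \in s ->
  gwa_op (gwa_sum s c) (dirac (i + k)) i = aut_pow sigma i (c k) * mon_weight k i.
Proof.
move=> s_uniq sk; rewrite gwa_op_sum (bigD1_seq k) //= /dirac eqxx mulr1.
by rewrite big1 ?addr0 // => j /negPf jk; rewrite (inj_eq (addrI i)) jk mulr0.
Qed.

Lemma gwa_op_dirac_out s c k i :
  k - i \notin s -> gwa_op (gwa_sum s c) (dirac k) i = 0.
Proof.
move=> sk; rewrite gwa_op_sum big_seq big1 // => j sj; rewrite /dirac.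
by case: eqP => [ij|]; rewrite ?mulr0 //; case/negP: sk; rewrite -ij addrAC subrr add0r.
Qed.

(** Apply the product to [dirac (M + N)] and evaluate at 0. Only the pair of degrees [M], [N]
    contributes, and its value is nonzero over a domain; the identity gives a nonzero value only if
    [M + N = 0]. *)
Lemma gwa_sum_mul1 s c t d M N : uniq s -> uniq t ->
    {in s, forall k, c k != 0} -> {in t, forall k, d k != 0} ->
    gwa_sum s c * gwa_sum t d = 1 -> M \in s -> N \in t ->
    {in s & t, forall m n, m + n = M + N -> m = M} ->
  M + N = 0.
Proof.
move=> us ut nzc nzd uv sM tN extr.
have := congr1 (fun u => gwa_op u (dirac (M + N)) 0) uv.
rewrite gwa_op1 gwa_opM gwa_op_sum (bigD1_seq M) //= big_seq_cond big1 ?addr0.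
  rewrite add0r gwa_op_dirac_in // /dirac.
  case: eqP => [<- //|_] /eqP; apply: contraTeq => _ /=.
  by rewrite !domain_mulf_neq0 ?aut_pow_eq0 ?nzc ?nzd ?mon_weight_neq0.
move=> m /andP[sm mM]; rewrite add0r gwa_op_dirac_out ?mulr0 //.
apply: contraNN mM => tn; apply/eqP/(extr _ _ sm tn).
by rewrite addrCA subrr addr0.
Qed.

Lemma mon_weight_Negz0 n : mon_weight (Negz n) 0 = a * y_weight n (- 1).
Proof. by rewrite /= add0r. Qed.

(* Extremal degrees of factors of 1 cancel, so both factors are homogeneous. *)
Lemma gwa_mul1_homogeneous (u v : A) : u * v = 1 ->
  exists m c d, u = inA c * gwa_mon m /\ v = inA d * gwa_mon (- m).
Proof.
have [s [c [us nzc ->]]] := gwa_normal_form u.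
have [t [d [ut nzd ->]]] := gwa_normal_form v.
move=> uv.
have s_nil : s != [::].
  by apply: contra_eq_neq uv => ->; rewrite /gwa_sum big_nil mul0r eq_sym oner_neq0.
have t_nil : t != [::].
  by apply: contra_eq_neq uv => ->; rewrite /gwa_sum big_nil mulr0 eq_sym oner_neq0.
have [M sM maxM] := seq_extremum s_nil.
have [N tN maxN] := seq_extremum t_nil.
have [M' sM' minM'] : exists2 m, m \in s & {in s, forall k, m <= k}.
  (* A minimum is a maximum for the dual order. *)
  exact: (@seq_extremum _ (int^d)%type).
have [N' tN' minN'] : exists2 m, m \in t & {in t, forall k, m <= k}.
  exact: (@seq_extremum _ (int^d)%type).
have MN0 : M + N = 0.
  apply: (gwa_sum_mul1 us ut nzc nzd) => // m n sm tn mnE; apply/le_anti.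
  have mM : m <= M := maxM _ sm; have nN : n <= N := maxN _ tn.
  by rewrite mM -(lerD2r N) -mnE lerD2l.
have MN0' : M' + N' = 0.
  apply: (gwa_sum_mul1 us ut nzc nzd) => // m n sm tn mnE; apply/le_anti.
  have mM' : M' <= m := minM' _ sm; have nN' : N' <= n := minN' _ tn.
  by rewrite mM' andbT -(lerD2r N') -mnE lerD2l.
(* Both pairs sum to 0 while [M' <= M] and [N' <= N], so neither inequality can be strict. *)
have MM' : M' = M.
  have mM' : M' <= M := minM' _ sM; have nN' : N' <= N := minN' _ tN.
  by apply/le_anti; rewrite mM' -(lerD2r N) MN0 -MN0' lerD2l.
have NN' : N' = N by apply: (addrI M); rewrite MN0 -MM'.
have seq1 (r : seq int) k : uniq r -> k \in r -> {in r, forall j, j = k} -> r = [:: k].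
  move=> ur rk rE; apply: perm_small_eq => //; apply: uniq_perm => // j.
  by rewrite inE; apply/idP/eqP => [/rE|->].
have sE : s = [:: M].
  apply: seq1 => // j sj; have jM : j <= M := maxM _ sj.
  by apply/le_anti; rewrite jM -MM'; apply: minM'.
have tE : t = [:: N].
  apply: seq1 => // j tj; have jN : j <= N := maxN _ tj.
  by apply/le_anti; rewrite jN -NN'; apply: minN'.
exists M, (c M), (d N); rewrite sE tE /gwa_sum !big_seq1.
by have -> : - M = N by apply/eqP; rewrite eq_sym -addr_eq0 addrC MN0.
Qed.

(** In nonzero degree exactly one factor contains a power of [y], whose weight has a factor [a] at
    place 0; centrality of [a] pulls it out of the product equal to 1. *)
Lemma gwa_mul1_in (u v : A) : (forall r, a * r != 1) -> u * v = 1 ->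
  exists r s, [/\ u = inA r, v = inA s & r * s = 1].
Proof.
move=> a_nunit uv; have [m [c [d [uE vE]]]] := gwa_mul1_homogeneous uv.
(* The place of evaluation is chosen so that the factor containing [y] acts at place 0, where [a]
   appears untwisted by [sigma]. For positive [m] that factor is [v], reached after a shift by
   [m]. *)
have op1 := congr1 (fun w => gwa_op w (fun=> 1) (if m is Posz _ then - m else 0)) uv.
rewrite gwa_op1 uE vE !gwa_opM gwa_op_in gwa_op_mon gwa_op_in gwa_op_mon mulr1 in op1.
case: m uE vE op1 => [[|n]|n] uE vE.
- move=> _; have {}uE : u = inA c by rewrite uE /= expr0 mulr1.
  have {}vE : v = inA d by rewrite vE /= expr0 mulr1.
  exists c, d; split=> //; apply: (@gwa_in_inj _ _ sigma a central_a).
  by rewrite rmorphM rmorph1 /= -uE -vE.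
- rewrite addNr (_ : - Posz n.+1 = Negz n) // mon_weight_Negz0 mul1r.
  rewrite [aut_pow _ 0 d * _]mulrA -central_a -mulrA [_ * (a * _)]mulrA -central_a -mulrA.
  by move/eqP; rewrite (negPf (a_nunit _)).
- rewrite mon_weight_Negz0 mulrA [_ * (a * _)]mulrA -central_a -!mulrA.
  by move/eqP; rewrite (negPf (a_nunit _)).
Qed.

End Units.
End GwaNormalForm.

(** * Units of the Laurent polynomials *)

Section LaurentUnits.
Variable K : fieldType.
Local Notation L := (laurent K).
Local Notation h := (laurentX K).

(** Clearing denominators gives polynomials with product a power of ['X], and a divisor of such a
    power is a scalar multiple of some ['X^k]. *)
Lemma laurent_unit_monomial (f g : L) : f * g = 1 -> laurent_monomial f.
Proof.
move=> fg; have [p [n fp]] := laurentE f; have [r [m gr]] := laurentE g.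
have pr : p * r = 'X^(n + m).
  apply: poly_laurent_inj; rewrite rmorphM rmorphXn /= -fp -gr mulrACA fg mul1r.
  by rewrite -exprD.
have: p %| ('X - 0%:P) ^+ (n + m) by rewrite subr0 -pr dvdp_mulr.
case/dvdp_exp_XsubCP => k _; rewrite subr0.
case/eqpP => -[c1 c2] /= /andP[c1_neq0 _] c12.
have pE : p = (c1^-1 * c2)%:P * 'X^k.
  by rewrite mul_polyC -scalerA -c12 scalerA mulVf // scale1r.
have hU := laurentX_unit K.
exists (c1^-1 * c2), (k%:Z - n%:Z).
apply: (mulIr (unitrX n hU)); rewrite fp pE rmorphM rmorphXn /=.
by rewrite -scalerAl -[h ^+ n]/(h ^ n%:Z) -exprzDr ?subrK.
Qed.

End LaurentUnits.

Theorem lemma3p6 (K : fieldType) (q : K) (q_neq0 : q != 0)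
    (q_sqrt : exists p : K, p ^+ 2 = q)
    (sigma_inv : alg_aut (laurent K))
    (sigma_inv_h : sigma_inv (laurentX K) = q *: (laurentX K)^-1)
    (a : laurent K) (a_nonmonomial : ~ laurent_monomial a)
    (u : gwa sigma_inv (mulrC a)) (u_unit : u \is a GRing.unit) :
  exists (alpha : K) (i : int),
    alpha != 0 /\ u = gwa_in sigma_inv (mulrC a) (alpha *: laurentX K ^ i).
Proof.
(* Zero counts as a monomial, with coefficient 0. *)
have a_neq0 : a != 0.
  by apply: contra_notN a_nonmonomial => /eqP->; exists 0, 0; rewrite scale0r.
have a_nunit r : a * r != 1.
  by apply: contra_notN a_nonmonomial => /eqP/laurent_unit_monomial.
have domL (r s : laurent K) : r * s = 0 -> (r == 0) || (s == 0).
  by move/eqP; rewrite mulf_eq0.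
have [r [s [-> _ rs]]] := gwa_mul1_in domL a_neq0 a_nunit (mulrV u_unit).
have [alpha [i rE]] := laurent_unit_monomial rs.
exists alpha, i; split; last by rewrite rE.
apply/eqP => alpha0; move: rs => /eqP.
by rewrite rE alpha0 scale0r mul0r eq_sym oner_eq0.
Qed.
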